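(* Let $X=X(\mathbb{T}^d,\mu;q)$, $0<q\le1$, be a quasi-Banach lattice. Assume that there exist constants $B_\alpha>0$, $\alpha\in\mathbb{Z}_+^d$, and $A>0$ such that for all $\alpha\in\mathbb{Z}_+^d$ $$\|D^\alpha T_n\|_X\le B_\alpha n^{|\alpha|_1}\|T_n\|_X,\qquad T_n\in\mathcal{T}_n^d,$$ and $\sum_{\alpha\in\mathbb{Z}_+^d\setminus\{0\}}\left(\frac{A^{|\alpha|_1}B_\alpha}{\alpha!}\right)^q<1$. Then, for all $T_n\in\mathcal{T}_n^d$ and $N\ge\frac{2\pi}An$, $$\|T_n\|_X\asymp\bigg\|\sum_{k_1=1}^N\cdots\sum_{k_d=1}^N|T_n(x_k)|\chi_{\Omega_k}\bigg\|_X,$$ where $x_k$ is an arbitrary point in $\Omega_k=\left[\frac{2\pi(k_1-1)}N,\frac{2\pi k_1}N\right]\times\dots\times\left[\frac{2\pi(k_d-1)}N,\frac{2\pi k_d}N\right]$, $k=(k_1,\dots,k_d)\in[1,N]^d$.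
   Context: $\mathbb{T}^d=[0,2\pi)^d$ with a positive $\sigma$-finite measure $\mu$. A quasi-Banach (function) lattice $X=X(\mathbb{T}^d,\mu;q)$, $0<q\le1$, is a complete space of functions on $\mathbb{T}^d$ with a functional $\|\cdot\|_X$ such that: 1) $\|f\|_X=0$ iff $f=0$; 2) $\|\lambda f\|_X=|\lambda|\|f\|_X$ for $\lambda\in\mathbb{C}$; 3) $\|f+g\|_X^q\le\|f\|_X^q+\|g\|_X^q$; 4) if $|f|\le|g|$ then $\|f\|_X\le\|g\|_X$ for $f,g\in X$; 5) $\chi_B\in X$ for all $B$ with $\mu(B)<\infty$. $\mathcal{T}_n^d$ is the set of trigonometric polynomials $T(x)=\sum_{k_1=-n}^n\cdots\sum_{k_d=-n}^nc_ke^{i(k,x)}$ of degree at most $n$ in each variable. $|\alpha|_1=\alpha_1+\dots+\alpha_d$, $\alpha!=\alpha_1!\cdots\alpha_d!$, $D^\alpha=\partial^{|\alpha|_1}/\partial x_1^{\alpha_1}\cdots\partial x_d^{\alpha_d}$. $A\asymp B$ means two-sided inequalities with positive constants independent of the essential variables (here $n$, $N$, $T_n$, and the points $x_k$). *)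

(* Defs.v *)
From HB Require Import structures.
From mathcomp Require Import all_boot all_order all_algebra.
From mathcomp Require Import all_classical all_reals all_analysis.
From mathcomp Require Import complex.

Set Implicit Arguments.
Unset Strict Implicit.
Unset Printing Implicit Defensive.

Import Order.TTheory GRing.Theory Num.Theory.
Import numFieldNormedType.Exports.

Local Open Scope classical_set_scope.
Local Open Scope ring_scope.
Local Open Scope complex_scope.

(* T^d is the subset [0, 2pi)^d of R^d = d.-tuple R, the latter carrying the
   product (Borel) sigma-algebra.  A function on T^d is represented by a
   function on R^d; every condition below only concerns its values on T^d,
   and a measure on T^d is the restriction to T^d of a measure on R^d. *)
Definition torus (R : realType) (d : nat) : set (d.-tuple R) :=
  [set x | forall j : 'I_d, 0 <= tnth x j < 2 * pi].
Arguments torus : clear implicits.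

Definition cabs (R : realType) (z : R[i]) : R := complex.Re `|z|.

(* Complex indicator function chi_A. *)
Definition cindic (R : realType) (d : nat) (A : set (d.-tuple R))
  : d.-tuple R -> R[i] := fun x => (\1_A x)%:C.

(* R[i] has no sigma-algebra in the library: measurability is that of the real
   and imaginary parts. *)
Definition cmeasurable (R : realType) (d : nat) (f : d.-tuple R -> R[i]) : Prop :=
  measurable_fun (torus R d) (fun x => complex.Re (f x)) /\
  measurable_fun (torus R d) (fun x => complex.Im (f x)).

Section Lattice.
Context (R : realType) (d : nat).
Local Notation pt := (d.-tuple R).
Variable mu : {measure set pt -> \bar R}.

(* Equality and order of functions are understood mu-almost everywhere on T^d:
   this is what makes "||f|| = 0 iff f = 0" meaningful.  X is the set of
   (representatives of) the elements of the space; N f is only meaningful for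
   X f.  qbl_mod is the word "lattice": the order is that of moduli. *)
Record quasi_banach_lattice (q : R) (X : set (pt -> R[i]))
    (N : (pt -> R[i]) -> R) : Prop := QuasiBanachLattice {
  qbl_meas : forall f, X f -> cmeasurable f;
  qbl_ae : forall f g, X f -> cmeasurable g ->
    {ae mu, forall x, torus R d x -> f x = g x} -> X g;
  qbl_add : forall f g, X f -> X g -> X (fun x => f x + g x);
  qbl_scale : forall (a : R[i]) f, X f -> X (fun x => a * f x);
  qbl_mod : forall f, X f -> X (fun x => (cabs (f x))%:C);
  qbl_norm_ge0 : forall f, X f -> 0 <= N f;
  qbl_norm_eq0 : forall f, X f ->
    (N f = 0 <-> {ae mu, forall x, torus R d x -> f x = 0});
  qbl_normZ : forall (a : R[i]) f, X f -> N (fun x => a * f x) = cabs a * N f;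
  qbl_normD : forall f g, X f -> X g ->
    N (fun x => f x + g x) `^ q <= N f `^ q + N g `^ q;
  qbl_norm_le : forall f g, X f -> X g ->
    {ae mu, forall x, torus R d x -> cabs (f x) <= cabs (g x)} -> N f <= N g;
  qbl_indic : forall B, measurable B -> B `<=` torus R d ->
    (mu B < +oo)%E -> X (cindic B);
  qbl_complete : forall u : nat -> pt -> R[i], (forall m, X (u m)) ->
    (forall e : R, 0 < e -> exists M : nat, forall m p : nat,
       (M <= m)%N -> (M <= p)%N -> N (fun x => u m x - u p x) < e) ->
    exists2 f, X f & (fun m => N (fun x => u m x - f x)) @ \oo --> (0 : R)
}.

(* The ideal property: a measurable function dominated by an element of X
   belongs to X.  It is often part of the definition of a function lattice;
   here it is kept apart, since monotonicity of the norm is required on X only. *)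
Definition solid (X : set (pt -> R[i])) : Prop :=
  forall f g, cmeasurable f -> X g ->
    {ae mu, forall x, torus R d x -> cabs (f x) <= cabs (g x)} -> X f.

End Lattice.

Section Trigonometric.
Context (R : realType) (d : nat).
Local Notation pt := (d.-tuple R).

Definition expi (t : R) : R[i] := cos t +i* sin t.

(* T belongs to T_n^d; the frequency -n <= k_j <= n is encoded as m j - n
   with 0 <= m j <= 2n. *)
Definition trigpoly (n : nat) (T : pt -> R[i]) : Prop :=
  exists c : {ffun 'I_d -> 'I_(2 * n).+1} -> R[i], T = fun x =>
    \sum_(m : {ffun 'I_d -> 'I_(2 * n).+1})
      c m * expi (\sum_(j < d) ((m j)%:R - n%:R) * tnth x j).

Definition subst_coord (x : pt) (j : 'I_d) (t : R) : pt :=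
  [tuple if i == j then t else tnth x i | i < d].

Definition partial (j : 'I_d) (f : pt -> R[i]) : pt -> R[i] := fun x =>
  derive1 (fun t : R => complex.Re (f (subst_coord x j t))) (tnth x j) +i*
  derive1 (fun t : R => complex.Im (f (subst_coord x j t))) (tnth x j).

Definition multiindex := {ffun 'I_d -> nat}.

Definition mi_deg (a : multiindex) : nat := (\sum_(j < d) a j)%N.
Definition mi_fact (a : multiindex) : nat := (\prod_(j < d) (a j)`!)%N.

Definition Dmi (a : multiindex) (f : pt -> R[i]) : pt -> R[i] :=
  foldr (fun j g => iter (a j) (partial j) g) f (enum 'I_d).

(* Indices run over [0, N-1] instead of [1, N]. *)
Definition cell (N : nat) (k : {ffun 'I_d -> 'I_N}) : set pt :=
  [set x | forall j : 'I_d,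
     2 * pi * (k j)%:R / N%:R <= tnth x j <= 2 * pi * (k j).+1%:R / N%:R].

Definition discretization (N : nat) (xi : {ffun 'I_d -> 'I_N} -> pt)
    (T : pt -> R[i]) : pt -> R[i] := fun x =>
  \sum_(k : {ffun 'I_d -> 'I_N}) (cabs (T (xi k)))%:C * cindic (cell k) x.

End Trigonometric.

(* Main.v *)
Require Import Defs.
From mathcomp Require Import all_boot all_order all_algebra.
From mathcomp Require Import all_classical all_reals all_analysis.
From mathcomp Require Import measurable_realfun complex.
From mathcomp Require Import ring lra.
Import Order.TTheory GRing.Theory Num.Theory.
Import numFieldNormedType.Exports.
Local Open Scope classical_set_scope.
Local Open Scope ring_scope.

(** By Taylor's formula, two points x, y of a common cell satisfy
    |T(y) - T(x)| <= G(x) := sum_(a <> 0) (2 pi / N)^|a| / a! |D^a T(x)|.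
    Since (2 pi / N) n <= A, Bernstein's inequality gives
    ||G||^q <= b ||T||^q with b := sum_(a <> 0) (A^|a| B_a / a!)^q < 1.
    As |T| <= D + G and D <= 2^d (|T| + G) for the discretization D (a point
    belongs to at most 2^d closed cells), the q-triangle inequality yields
    (1 - b) ||T||^q <= ||D||^q <= 2^(dq) (1 + b) ||T||^q.  G itself need not
    belong to X; it is replaced by a majorant obtained from completeness. *)

(** * Real-valued modulus of complex numbers *)

Section ComplexModulus.
Context {R : realType}.
Implicit Types (z w : R[i]) (a : R).

Lemma cabsE z : (cabs z)%:C%C = `|z|.
Proof. by rewrite /cabs normc_def. Qed.

Lemma cabs_ge0 z : 0 <= cabs z.
Proof. by have := normr_ge0 z; rewrite -cabsE lecR. Qed.

Lemma cabs0 : cabs (0 : R[i]) = 0.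
Proof. by rewrite /cabs normr0. Qed.

Lemma cabsD z w : cabs (z + w) <= cabs z + cabs w.
Proof. by rewrite -lecR rmorphD !cabsE; exact: ler_normD. Qed.

Lemma cabsM z w : cabs (z * w) = cabs z * cabs w.
Proof. by apply: complexI; rewrite rmorphM/= !cabsE normrM. Qed.

Lemma cabsC z w : cabs (z - w) = cabs (w - z).
Proof. by rewrite /cabs distrC. Qed.

Lemma cabsB z w u : cabs (z - u) <= cabs (z - w) + cabs (w - u).
Proof. by rewrite (le_trans _ (cabsD _ _))// addrA subrK. Qed.

Lemma cabs_real a : cabs a%:C%C = `|a|.
Proof. by apply: complexI; rewrite cabsE normc_def/= expr0n/= addr0 sqrtr_sqr. Qed.

Lemma cabs_ReIm z : cabs z <= `|complex.Re z| + `|complex.Im z|.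
Proof.
rewrite /cabs normc_def/= -[leRHS]ger0_norm ?addr_ge0// -sqrtr_sqr ler_wsqrtr//.
by rewrite sqrrD !real_normK ?num_real// lerD2r lerDl mulrn_wge0// mulr_ge0.
Qed.

Lemma cabs_sum I (r : seq I) (P : pred I) (F : I -> R[i]) :
  cabs (\sum_(i <- r | P i) F i) <= \sum_(i <- r | P i) cabs (F i).
Proof.
elim/big_ind2: _ => [|x a y b xa yb|//]; first by rewrite cabs0.
by rewrite (le_trans (cabsD _ _))// lerD.
Qed.

Lemma cabs_dist_le z w : `|cabs z - cabs w| <= cabs (z - w).
Proof.
have H (u v : R[i]) : cabs u - cabs v <= cabs (u - v).
  by rewrite lerBlDr -{1}(subrK v u) cabsD.
by rewrite ler_norml H andbT lerNl opprB cabsC H.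
Qed.

End ComplexModulus.

(** * Convergence of complex sequences *)

Section ComplexConvergence.
Context {R : realType}.
Implicit Types (u v : nat -> R[i]) (l m : R[i]).

(** Convergence is taken componentwise, so that the real power series of cosine and sine apply
    directly. *)
Definition ccvg u l :=
  (fun n => complex.Re (u n)) @ \oo --> complex.Re l /\
  (fun n => complex.Im (u n)) @ \oo --> complex.Im l.

Lemma ccvg_cst l : ccvg (fun=> l) l.
Proof. by split; exact: cvg_cst. Qed.

Lemma ccvgD u v l m : ccvg u l -> ccvg v m -> ccvg (fun n => u n + v n) (l + m).
Proof.
move=> [ul1 ul2] [vl1 vl2]; split; rewrite raddfD.
- by under eq_fun do rewrite raddfD; exact: cvgD.
- by under eq_fun do rewrite raddfD; exact: cvgD.
Qed.

Lemma ccvgM u v l m : ccvg u l -> ccvg v m -> ccvg (fun n => u n * v n) (l * m).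
Proof.
have ReM (z w : R[i]) : complex.Re (z * w) =
    complex.Re z * complex.Re w - complex.Im z * complex.Im w by case: z w => ? ? [].
have ImM (z w : R[i]) : complex.Im (z * w) =
    complex.Re z * complex.Im w + complex.Im z * complex.Re w by case: z w => ? ? [].
move=> [ul1 ul2] [vl1 vl2]; split; rewrite ?(ReM, ImM).
- by under eq_fun do rewrite ReM; apply: cvgB; exact: cvgM.
- by under eq_fun do rewrite ImM; apply: cvgD; exact: cvgM.
Qed.

Lemma ccvg_sum I (r : seq I) (u : I -> nat -> R[i]) (l : I -> R[i]) :
  (forall i, ccvg (u i) (l i)) ->
  ccvg (fun n => \sum_(i <- r) u i n) (\sum_(i <- r) l i).
Proof.
move=> ul; elim: r => [|i r IH].
  by rewrite big_nil; under eq_fun do rewrite big_nil; exact: ccvg_cst.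
by rewrite big_cons; under eq_fun do rewrite big_cons; exact: ccvgD.
Qed.

Lemma ccvg_prod I (r : seq I) (u : I -> nat -> R[i]) (l : I -> R[i]) :
  (forall i, ccvg (u i) (l i)) ->
  ccvg (fun n => \prod_(i <- r) u i n) (\prod_(i <- r) l i).
Proof.
move=> ul; elim: r => [|i r IH].
  by rewrite big_nil; under eq_fun do rewrite big_nil; exact: ccvg_cst.
by rewrite big_cons; under eq_fun do rewrite big_cons; exact: ccvgM.
Qed.

(** The index is a successor because the Taylor sums below run over ['I_n.+1], which must contain
    0. *)
Lemma ccvg_near u l (e : R) : ccvg u l -> 0 < e -> exists n, cabs (l - u n.+1) < e.
Proof.
move=> [ul1 ul2] e0; have e20 : 0 < e / 2 by rewrite divr_gt0.
have /cvgrPdist_lt/(_ _ e20) := ul1; have /cvgrPdist_lt/(_ _ e20) := ul2.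
move=> [n1 _ n1P] [n2 _ n2P]; exists (maxn n1 n2).
rewrite (le_lt_trans (cabs_ReIm _))// [ltRHS]splitr ltrD// raddfB.
- by apply: n2P; rewrite /= leqW// leq_maxr.
- by apply: n1P; rewrite /= leqW// leq_maxl.
Qed.

End ComplexConvergence.

(** * Power series of exp(it) *)

Section ExpSeries.
Context {R : realType}.

(** Even and odd powers are separated in the format of [cos_coeff] and [sin_coeff]. *)
Lemma imC_exp (t : R) r : (0 +i* t)%C ^+ r =
  ((~~ odd r)%:R * (-1) ^+ r./2 * t ^+ r +i* ((odd r)%:R * (-1) ^+ r.-1./2 * t ^+ r))%C.
Proof.
elim: r => [|r IH]; first by rewrite !expr0 !mul1r /= !mul0r.
rewrite exprS IH; case: r {IH} => [|r]; first by rewrite mulr1 /= !(mul0r, mul1r, mulr1, expr0, expr1).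
simpc; rewrite /= ; congr (_ +i* _)%C; rewrite ?uphalf_half ?negbK; case: (odd r) => /=;
  rewrite ?(mul0r, mulr0, add0n, add1n, mul1r) ?oppr0// !exprS; ring.
Qed.

Lemma expi_series (t : R) :
  ccvg (fun n => \sum_(r < n) (0 +i* t)%C ^+ r / r`!%:R) (expi t).
Proof.
have C r : (0 +i* t)%C ^+ r / r`!%:R = (cos_coeff t r +i* sin_coeff t r)%C.
  rewrite imC_exp /cos_coeff /sin_coeff/=.
  have -> : r`!%:R = (r`!%:R : R)%:C%C :> R[i] by rewrite rmorph_nat.
  by rewrite -fmorphV; simpc.
split=> /=.
- under eq_fun do rewrite raddf_sum/=; under eq_fun do under eq_bigr do rewrite C/=.
  have := @is_cvg_series_cos_coeff R t; rewrite unlock /series/=.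
  by under eq_fun do rewrite big_mkord.
- under eq_fun do rewrite raddf_sum/=; under eq_fun do under eq_bigr do rewrite C/=.
  have := @is_cvg_series_sin_coeff R t; rewrite unlock /series/=.
  by under eq_fun do rewrite big_mkord.
Qed.

Lemma expiD (s t : R) : expi (s + t) = expi s * expi t.
Proof. by rewrite /expi cosD sinD; simpc; rewrite [X in (_ +i* X)%C]addrC. Qed.

Lemma expi0 : expi (0 : R) = 1.
Proof. by rewrite /expi cos0 sin0. Qed.

Lemma expi_sum I (r : seq I) (F : I -> R) :
  expi (\sum_(i <- r) F i) = \prod_(i <- r) expi (F i).
Proof. by apply: (big_morph _ expiD expi0). Qed.

End ExpSeries.

(** * Derivatives and Taylor expansion of exponential sums *)

Section ExponentialSums.
Context {R : realType}.

(** Along one coordinate each phase is affine: [k i] is the frequency in that coordinate, and [s i]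
    collects the coordinates held fixed. *)
Lemma is_derive_expsum I (r : seq I) (c : I -> R[i]) (k s : I -> R) (t : R) :
  is_derive t 1
    (fun u => complex.Re (\sum_(i <- r) c i * expi (k i * u + s i)))
    (complex.Re (\sum_(i <- r) c i * (0 +i* k i)%C * expi (k i * t + s i))) /\
  is_derive t 1
    (fun u => complex.Im (\sum_(i <- r) c i * expi (k i * u + s i)))
    (complex.Im (\sum_(i <- r) c i * (0 +i* k i)%C * expi (k i * t + s i))).
Proof.
elim: r => [|i r [IHr IHi]].
  rewrite big_nil; split;
    by under eq_fun do rewrite big_nil; exact: is_derive_cst.
have lin : is_derive t (1 : R) (fun u : R => k i * u + s i) (k i).
  by apply: is_derive_eq; rewrite /GRing.scale/= mulr1 addr0.
have dcos : is_derive t (1 : R) (fun u : R => cos (k i * u + s i))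
    (k i * - sin (k i * t + s i)).
  rewrite mulrC; exact: is_derive1_comp.
have dsin : is_derive t (1 : R) (fun u : R => sin (k i * u + s i))
    (k i * cos (k i * t + s i)).
  rewrite mulrC; exact: is_derive1_comp.
rewrite big_cons; split; rewrite raddfD.
- under eq_fun do rewrite big_cons raddfD.
  apply: is_deriveD; case: (c i) => a b.
  under eq_fun do rewrite /expi/=.
  by apply: is_derive_eq; rewrite /GRing.scale/=; ring.
- under eq_fun do rewrite big_cons raddfD.
  apply: is_deriveD; case: (c i) => a b.
  under eq_fun do rewrite /expi/=.
  by apply: is_derive_eq; rewrite /GRing.scale/=; ring.
Qed.

Context {d : nat}.
Local Notation pt := (d.-tuple R).

(** Leaving frequencies and index type arbitrary gives a class stable under [partial]:
    differentiation changes only the coefficients. *)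
Definition expsum {I : finType} (c : I -> R[i]) (k : I -> 'I_d -> R) : pt -> R[i] :=
  fun x => \sum_i c i * expi (\sum_(j < d) k i j * tnth x j).

Lemma partial_expsum {I : finType} (c : I -> R[i]) (k : I -> 'I_d -> R) j :
  partial j (expsum c k) = expsum (fun i => c i * (0 +i* k i j)%C) k.
Proof.
apply/funext => x; rewrite /partial /expsum.
pose s i := \sum_(l < d | l != j) k i l * tnth x l.
have E i u : \sum_(l < d) k i l * tnth (subst_coord x j u) l = k i j * u + s i.
  rewrite (bigD1 j)//= tnth_mktuple eqxx; congr (_ + _).
  by apply: eq_bigr => l lj; rewrite tnth_mktuple (negbTE lj).
under [fun t => complex.Re _]eq_fun do under eq_bigr do rewrite E.
under [fun t => complex.Im _]eq_fun do under eq_bigr do rewrite E.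
under [RHS]eq_bigr => i _ do rewrite (bigD1 j)//= -/(s i).
have [dr di] := is_derive_expsum I (index_enum I) c (k ^~ j) s (tnth x j).
by rewrite !derive1E !derive_val; case: (\sum_(i <- _) _).
Qed.

(** Each exponential is an eigenfunction of [partial j] with eigenvalue i k_j. *)
Lemma Dmi_expsum {I : finType} (c : I -> R[i]) (k : I -> 'I_d -> R) (a : multiindex d) :
  Dmi a (expsum c k) = expsum (fun i => c i * \prod_j (0 +i* k i j)%C ^+ a j) k.
Proof.
have it c' j r : iter r (partial j) (expsum c' k) =
    expsum (fun i => c' i * (0 +i* k i j)%C ^+ r) k.
  elim: r => [|r IH] /=; first by under [in RHS]eq_fun do rewrite expr0 mulr1.
  by rewrite IH partial_expsum; under eq_fun do rewrite -mulrA -exprSr.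
rewrite /Dmi; under [in RHS]eq_fun do rewrite -big_enum/=.
elim: (enum _) => [|j r IH] /=.
  by under [in RHS]eq_fun do rewrite big_nil mulr1.
rewrite IH it; under [in RHS]eq_fun do rewrite big_cons.
by under eq_fun do rewrite -mulrA [X in _ * X]mulrC.
Qed.

(** The multi-indices with all entries below n, as the image of a finite type: these boxes index the
    truncated Taylor sums. *)
Definition mi_of_ord n (a : {ffun 'I_d -> 'I_n}) : multiindex d :=
  [ffun j => a j : nat].

Lemma mi_of_ord_inj n : injective (@mi_of_ord n).
Proof.
move=> a b /ffunP ab; apply/ffunP => j; apply: val_inj.
by have := ab j; rewrite !ffunE.
Qed.

(** The exponential at y is the exponential at x times the product over j of exp(i k_j (y_j - x_j)).
    Truncating each factor at n terms and expanding the product gives exactly the Taylor sum over a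
    box, so d one-variable series suffice. *)
Lemma expsum_taylor {I : finType} (c : I -> R[i]) (k : I -> 'I_d -> R) (x y : pt) :
  ccvg (fun n => \sum_(a : {ffun 'I_d -> 'I_n}) Dmi (mi_of_ord n a) (expsum c k) x *
      (\prod_j ((tnth y j - tnth x j) ^+ a j / (a j)`!%:R))%:C%C)
    (expsum c k y).
Proof.
have -> : expsum c k y = \sum_i c i * expi (\sum_j k i j * tnth x j) *
    \prod_j expi (k i j * (tnth y j - tnth x j)).
  apply: eq_bigr => i _; rewrite -mulrA -expi_sum -expiD -big_split/=.
  by congr (_ * expi _); apply: eq_bigr => j _; rewrite -mulrDr addrC subrK.
pose u i n := c i * expi (\sum_j k i j * tnth x j) *
    \prod_j \sum_(r < n) (0 +i* (k i j * (tnth y j - tnth x j)))%C ^+ r / r`!%:R.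
have := @ccvg_sum _ _ (index_enum I) u.
move=> /(_ (fun i => c i * expi (\sum_j k i j * tnth x j) *
    \prod_j expi (k i j * (tnth y j - tnth x j)))).
have -> : (fun n => \sum_i u i n) = (fun n => \sum_(a : {ffun 'I_d -> 'I_n})
    Dmi (mi_of_ord n a) (expsum c k) x *
      (\prod_j ((tnth y j - tnth x j) ^+ a j / (a j)`!%:R))%:C%C).
  apply/funext => n; rewrite /u.
  under eq_bigr do rewrite bigA_distr_bigA mulr_sumr.
  rewrite exchange_big/=; apply: eq_bigr => a _.
  rewrite Dmi_expsum mulr_suml; apply: eq_bigr => i _.
  rewrite -!mulrA; congr (_ * _); rewrite [RHS]mulrCA; congr (_ * _).
  rewrite rmorph_prod -big_split/=; apply: eq_bigr => j _.
  rewrite ffunE rmorphM fmorphV rmorphXn rmorph_nat/= mulrA -exprMn.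
  by simpc.
apply => i; apply: ccvgM; first exact: ccvg_cst.
apply: ccvg_prod => j; exact: expi_series.
Qed.

(** Weight 0 at the zero multi-index removes the value at x itself, while sums may still run over
    all multi-indices. *)
Definition taylor_weight (e : R) (a : multiindex d) : R :=
  if a == [ffun=> 0%N] then 0 else e ^+ mi_deg a / (mi_fact a)%:R.

Lemma taylor_weight_ge0 e a : 0 <= e -> 0 <= taylor_weight e a.
Proof.
by move=> e0; rewrite /taylor_weight; case: ifP => // _; rewrite divr_ge0// exprn_ge0.
Qed.

(** A common bound g of all finite sums stands in for the infinite series. Up to an arbitrary h > 0,
    the increment is a box-truncated Taylor sum without its constant term, and this is dominated by
    one of those finite sums. *)
Lemma expsum_dist_le {I : finType} (c : I -> R[i]) (k : I -> 'I_d -> R)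
    (x y : pt) (e g : R) :
  (forall j, `|tnth y j - tnth x j| <= e) ->
  (forall s, uniq s ->
    \sum_(a <- s) taylor_weight e a * cabs (Dmi a (expsum c k) x) <= g) ->
  cabs (expsum c k y - expsum c k x) <= g.
Proof.
move=> yx sg; apply/ler_addgt0Pr => h h0.
have [n] := ccvg_near _ _ _ (expsum_taylor c k x y) h0.
set p := \sum_a _ => ph.
rewrite (le_trans (cabsB _ p _))// addrC lerD ?(ltW ph)//.
have /sg : uniq [seq mi_of_ord n.+1 a | a : {ffun 'I_d -> 'I_n.+1}].
  by rewrite map_inj_uniq ?enum_uniq//; exact: mi_of_ord_inj.
apply: le_trans; rewrite big_map big_enum/=.
(* The term of the zero multi-index is the value at x: it cancels on the left and has weight 0 on
   the right. *)
pose z : {ffun 'I_d -> 'I_n.+1} := [ffun=> ord0].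
have z0 : mi_of_ord n.+1 z = [ffun=> 0%N] by apply/ffunP => j; rewrite !ffunE.
rewrite /p (bigD1 z)//= [leRHS](bigD1 z)//= z0.
rewrite {1}/taylor_weight eqxx mul0r add0r.
have -> : \prod_j ((tnth y j - tnth x j) ^+ z j / (z j)`!%:R) = 1 :> R.
  by rewrite big1// => j _; rewrite ffunE expr0 divr1.
rewrite Dmi_expsum rmorph1 mulr1.
have -> : (fun i => c i * \prod_j (0 +i* k i j)%C ^+ [ffun=> 0%N] j) = c.
  by apply/funext => i; rewrite big1 ?mulr1// => j _; rewrite ffunE.
rewrite addrAC subrr add0r (le_trans (cabs_sum _ _ _ _))// ler_sum// => a az.
rewrite cabsM mulrC cabs_real ler_wpM2r ?cabs_ge0// /taylor_weight.
rewrite -z0 (inj_eq (mi_of_ord_inj _)) (negbTE az) /mi_deg /mi_fact.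
rewrite natr_prod -prodfV expr_sum -big_split/= normr_prod ler_prod// => j _.
rewrite normr_ge0/= normrM normfV normr_nat normrX ffunE.
by rewrite ler_wpM2r ?invr_ge0// lerXn2r ?nnegrE ?(le_trans _ (yx j)).
Qed.

Lemma trigpoly_dist_le n (T : pt -> R[i]) (x y : pt) (e g : R) : trigpoly n T ->
  (forall j, `|tnth y j - tnth x j| <= e) ->
  (forall s, uniq s ->
    \sum_(a <- s) taylor_weight e a * cabs (Dmi a T x) <= g) ->
  cabs (T y - T x) <= g.
Proof. by move=> [c ->]; exact: expsum_dist_le. Qed.

End ExponentialSums.

(** * Real-valued elements of the lattice and dominated series *)

Section QuasiBanachLattice.
Context {R : realType} {d : nat}.
Local Notation pt := (d.-tuple R).
Context {mu : {measure set pt -> \bar R}} {q : R}.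
Context {X : set (pt -> R[i])} {N : (pt -> R[i]) -> R}.
Context (hX : quasi_banach_lattice mu q X N) (q0 : 0 < q).

(** The majorants are real functions, while the lattice consists of complex ones. *)
Definition rc (r : pt -> R) : pt -> R[i] := fun x => (r x)%:C%C.

Lemma powR_le_inj (a b : R) : 0 <= a -> 0 <= b -> a `^ q <= b `^ q -> a <= b.
Proof.
move=> a0 b0; rewrite !leNgt; apply: contra.
by apply: gt0_ltr_powR; rewrite ?nnegrE.
Qed.

Lemma lattice0 : X (rc (fun=> 0)).
Proof.
have -> : rc (fun=> 0) = cindic (set0 : set pt).
  by apply/funext => x; rewrite /rc /cindic indic0.
by apply: (qbl_indic hX) => //; rewrite measure0 ltry.
Qed.

Lemma latticeB f g : X f -> X g -> X (fun x => f x - g x).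
Proof.
move=> Xf /(qbl_scale hX (-1)) Xg; have := qbl_add hX Xf Xg.
by under eq_fun do rewrite mulN1r.
Qed.

Lemma norm_le f g : X f -> X g -> (forall x, cabs (f x) <= cabs (g x)) -> N f <= N g.
Proof. by move=> Xf Xg fg; apply: (qbl_norm_le hX) => //; apply: aeW => x. Qed.

Lemma norm_cabs_eq f g : X f -> X g -> (forall x, cabs (f x) = cabs (g x)) -> N f = N g.
Proof. by move=> Xf Xg fg; apply/eqP; rewrite eq_le !norm_le// => x; rewrite fg. Qed.

Lemma norm_mod f : X f -> N (rc (fun x => cabs (f x))) = N f.
Proof.
move=> Xf; apply: norm_cabs_eq => //; first exact: (qbl_mod hX).
by move=> x; rewrite cabs_real ger0_norm// cabs_ge0.
Qed.

Lemma norm0 : N (rc (fun=> 0)) = 0.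
Proof. by apply/(qbl_norm_eq0 hX lattice0); apply: aeW. Qed.

Lemma rcD f g : X (rc f) -> X (rc g) -> X (rc (fun x => f x + g x)).
Proof.
move=> Xf Xg; have := qbl_add hX Xf Xg.
by rewrite /rc; under [in X in _ -> X]eq_fun do rewrite rmorphD.
Qed.

Lemma rcZ (a : R) f : X (rc f) -> X (rc (fun x => a * f x)).
Proof.
move=> Xf; have := qbl_scale hX a%:C%C Xf.
by rewrite /rc; under [in X in _ -> X]eq_fun do rewrite rmorphM.
Qed.

Lemma norm_rcZ (a : R) f : 0 <= a -> X (rc f) -> N (rc (fun x => a * f x)) = a * N (rc f).
Proof.
move=> a0 Xf; have := qbl_normZ hX a%:C%C Xf; rewrite cabs_real ger0_norm// => <-.
by congr N; apply/funext => x; rewrite /rc rmorphM.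
Qed.

Lemma norm_rcD f g : X (rc f) -> X (rc g) ->
  N (rc (fun x => f x + g x)) `^ q <= N (rc f) `^ q + N (rc g) `^ q.
Proof.
move=> Xf Xg; have := qbl_normD hX Xf Xg.
by rewrite /rc; under [in X in _ -> X]eq_fun do rewrite rmorphD.
Qed.

Lemma rc_sum I (s : seq I) (h : I -> pt -> R) : (forall a, X (rc (h a))) ->
  X (rc (fun x => \sum_(a <- s) h a x)) /\
  N (rc (fun x => \sum_(a <- s) h a x)) `^ q <= \sum_(a <- s) N (rc (h a)) `^ q.
Proof.
move=> Xh; elim: s => [|a s [IHX IHN]].
  rewrite big_nil; under eq_fun do rewrite big_nil.
  by rewrite norm0 powR0 ?gt_eqF//; split=> //; exact: lattice0.
rewrite big_cons; under eq_fun do rewrite big_cons; split; first exact: rcD.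
by rewrite (le_trans (norm_rcD _ _ _ _))// lerD2l.
Qed.

(* The limit in norm of the partial sums dominates each of them: the positive
   part of S_m - g is at most |S_p - g| for all p >= m, so its norm is 0. *)
Lemma dominated_sum (I : countType) (h : I -> pt -> R) (b : R) :
  (forall a x, 0 <= h a x) -> (forall a, X (rc (h a))) ->
  (forall s, uniq s -> \sum_(a <- s) N (rc (h a)) `^ q <= b) ->
  exists g : pt -> R, [/\ X (rc g), (forall x, 0 <= g x), N (rc g) `^ q <= b &
    {ae mu, forall x, torus R d x -> forall s, uniq s -> \sum_(a <- s) h a x <= g x}].
Proof.
move=> h0 Xh sb.
(* Enumeration of the countable index type by codes: [r m p] lists the indices with code in [m, m +
   p). *)
pose r m p : seq I := pmap pickle_inv (iota m p).
have r_uniq m p : uniq (r m p) by rewrite (pmap_uniq pickle_invK) ?iota_uniq.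
pose S m x := \sum_(a <- r 0%N m) h a x.
pose v m := \sum_(a <- r 0%N m) N (rc (h a)) `^ q.
have XS m : X (rc (S m)) by exact: (rc_sum _ _ _ Xh).1.
have r_cat m p : (m <= p)%N -> r 0%N p = r 0%N m ++ r m (p - m)%N.
  by move=> mp; rewrite /r -pmap_cat -[p in LHS](subnKC mp) iotaD.
have v_sub m p : (m <= p)%N -> v p = v m + \sum_(a <- r m (p - m)%N) N (rc (h a)) `^ q.
  by move=> mp; rewrite /v (r_cat _ _ mp) big_cat.
have S_sub m p : (m <= p)%N -> forall x, S p x = S m x + \sum_(a <- r m (p - m)%N) h a x.
  by move=> mp x; rewrite /S (r_cat _ _ mp) big_cat.
have S_nd m p x : (m <= p)%N -> S m x <= S p x.
  by move=> mp; rewrite (S_sub _ _ mp) lerDl sumr_ge0.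
have v_nd m p : (m <= p)%N -> v m <= v p.
  by move=> mp; rewrite (v_sub _ _ mp) lerDl sumr_ge0// => a _; exact: powR_ge0.
have v_sup : has_sup (range v).
  by split; [exists (v 0%N); exists 0%N|exists b => _ [m _ <-]; exact: sb].
have XSB m p : X (fun x => rc (S m) x - rc (S p) x) by exact: latticeB.
have S_cauchy (e : R) : 0 < e -> exists M : nat, forall m p : nat,
    (M <= m)%N -> (M <= p)%N -> N (fun x => rc (S m) x - rc (S p) x) < e.
  (* Past M, chosen near the supremum of v, the increments of v stay below e^q, and they bound the
     q-th power of the norm of S m - S p. *)
  move=> e0; have eq0 : 0 < e `^ q by exact: powR_gt0.
  have [_ [M _ <-] vM] := sup_adherent eq0 v_sup.
  exists M => m p Mm Mp; wlog mp : m p Mm Mp / (m <= p)%N.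
    move=> H; have [/H|/ltnW/H] := leqP m p; first exact.
    move=> /(_ Mp Mm); rewrite (norm_cabs_eq _ _ (XSB m p) (XSB p m))// => x.
    exact: cabsC.
  have [Xr Nr] := rc_sum _ (r m (p - m)%N) _ Xh.
  rewrite (norm_cabs_eq _ _ (XSB m p) Xr); last first.
    by move=> x; rewrite cabsC /rc (S_sub _ _ mp) rmorphD addrAC subrr add0r.
  rewrite ltNge; apply/negP => /(ge0_ler_powR (ltW q0)).
  rewrite !nnegrE (ltW e0) (qbl_norm_ge0 hX Xr).
  move=> /(_ isT isT); apply/negP; rewrite -ltNge.
  rewrite (le_lt_trans Nr)//.
  have := v_sub _ _ mp; have := v_nd _ _ Mm.
  have : v p <= sup (range v) by apply: ub_le_sup; [case: v_sup|exists p].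
  by move: vM; lra.
have [f Xf Sf] := @qbl_complete _ _ _ _ _ _ hX (fun m => rc (S m)) XS S_cauchy.
(* The limit f may be complex; its modulus is still a limit of the nonnegative sums S m, since
   taking moduli does not increase distances. *)
pose g x := cabs (f x).
have Xg : X (rc g) by exact: (qbl_mod hX).
have XSg m : X (rc (fun x => `|S m x - g x|)).
  have := qbl_mod hX (latticeB _ _ (XS m) Xg).
  by rewrite /rc; under [in X in X -> _]eq_fun do rewrite -rmorphB cabs_real.
have S0 m x : 0 <= S m x by exact: sumr_ge0.
have NSg m : N (rc (fun x => `|S m x - g x|)) <= N (fun x => rc (S m) x - f x).
  apply: norm_le => //; first exact: latticeB.
  move=> x; rewrite cabs_real normr_id (le_trans _ (cabs_dist_le _ _))//.
  by rewrite cabs_real (ger0_norm (S0 _ _)).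
have Sg_near (e : R) m : 0 < e -> exists2 p, (m <= p)%N &
    N (rc (fun x => `|S p x - g x|)) < e.
  move=> e0; have /cvgrPdist_lt/(_ _ e0)[p _ pP] := Sf.
  exists (maxn m p); first exact: leq_maxl.
  rewrite (le_lt_trans (NSg _))//; have := pP (maxn m p) (leq_maxr _ _).
  by rewrite sub0r normrN; apply: le_lt_trans; exact: ler_norm.
exists g; split=> //; first by move=> x; exact: cabs_ge0.
- apply/ler_addgt0Pr => e e0.
  (* The bound follows from g <= S p + |S p - g|; the tolerance e^(1/q) is the one whose q-th power
     is e. *)
  have [p _ pe] := Sg_near (e `^ q^-1) 0%N (powR_gt0 _ e0).
  have Ng : N (rc g) <= N (rc (fun x => S p x + `|S p x - g x|)).
    apply: norm_le => //; first exact: rcD.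
    move=> x; rewrite !cabs_real ger0_norm ?cabs_ge0// ger0_norm ?addr_ge0//.
    by rewrite -lerBlDl -normrN opprB ler_norm.
  have : N (rc g) `^ q <= N (rc (fun x => S p x + `|S p x - g x|)) `^ q.
    by rewrite ge0_ler_powR ?nnegrE ?(ltW q0)// (qbl_norm_ge0 hX)//; exact: rcD.
  move=> /le_trans; apply; rewrite (le_trans (norm_rcD _ _ _ _))// lerD//.
    by rewrite (le_trans (rc_sum _ _ _ Xh).2)// sb.
  have -> : e = (e `^ q^-1) `^ q by rewrite -powRrM mulVf ?gt_eqF// powRr1// ltW.
  by rewrite ge0_ler_powR ?nnegrE ?powR_ge0 ?(ltW q0) ?(ltW pe)// (qbl_norm_ge0 hX).
- have SG m : {ae mu, forall x, torus R d x -> S m x <= g x}.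
    (* The positive part of y = S m - g, written (y + |y|)/2 so that it belongs to X by linearity
       and [XSg]. *)
    pose pos x := 2^-1 * ((S m x + (-1) * g x) + `|S m x - g x|).
    have Xpos : X (rc pos) by apply/rcZ/rcD => //; apply/rcD => //; exact: rcZ.
    have posE x : pos x = Num.max (S m x - g x) 0.
      rewrite /pos mulN1r; case: (leP 0 (S m x - g x)) => H.
        by rewrite ger0_norm//; lra.
      by rewrite ltr0_norm//; lra.
    have pos0 : N (rc pos) = 0.
      apply/eqP; rewrite eq_le (qbl_norm_ge0 hX)// andbT.
      apply/ler_addgt0Pr => e e0; rewrite add0r.
      have [p mp pe] := Sg_near e m e0.
      rewrite (le_trans _ (ltW pe))//; apply: norm_le => // x.
      rewrite !cabs_real posE normr_id ger0_norm ?le_max ?lexx ?orbT//.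
      rewrite ge_max normr_ge0 andbT (le_trans _ (ler_norm _))// lerD2r.
      exact: S_nd.
    have := (qbl_norm_eq0 hX Xpos).1 pos0.
    apply: filterS => x H /H; rewrite /rc => /(congr1 (@complex.Re R))/=.
    by rewrite posE => pos_x; rewrite -subr_le0 -[leRHS]pos_x le_max lexx.
  (* One null set is discarded for each m. Any finite s is contained in [r 0 m] once m exceeds all
     its codes, and the extra terms are nonnegative. *)
  have /ae_foralln := SG; apply: filterS => x H tx s us.
  pose m := (\max_(a <- s) pickle a).+1.
  have sr : perm_eq s [seq a <- r 0%N m | a \in s].
    apply: uniq_perm => //; first exact: filter_uniq.
    move=> a; rewrite mem_filter; case: (boolP (a \in s)) => //= sa.
    rewrite mem_pmap -pickleK_inv map_f// mem_iota/= add0n ltnS.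
    exact: leq_bigmax_seq.
  rewrite (le_trans _ (H m tx))// /S [leRHS](bigID (mem s))/=.
  by rewrite (perm_big _ sr) big_filter lerDl sumr_ge0.
Qed.

End QuasiBanachLattice.

(** * Geometry of the grid: covering, overlap and diameter of the cells *)

Section Cells.
Context {R : realType} {d N : nat}.
Local Notation pt := (d.-tuple R).
Local Notation idx := {ffun 'I_d -> 'I_N}.
Implicit Types (x y : pt) (k : idx) (xi : idx -> pt).

Lemma measurable_box (I : 'I_d -> interval R) :
  measurable [set x : pt | forall j, tnth x j \in I j].
Proof.
rewrite [X in measurable X](_ : _ = \bigcap_(j in [set: 'I_d]) (fun x => tnth x j) @^-1` [set` I j]).
  apply: fin_bigcap_measurable => // j _; rewrite -[X in measurable X]setTI.
  by apply: measurable_tnth => //; exact: measurable_itv.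
by apply/seteqP; split => x /= H j; [move=> _; exact: H|exact: H].
Qed.

Lemma measurable_torus : measurable (torus R d).
Proof.
rewrite [X in measurable X](_ : _ = [set x : pt | forall j, tnth x j \in `[0, 2 * pi[]).
  exact: measurable_box.
by apply/seteqP; split => x /= H j; have := H j; rewrite in_itv.
Qed.

Lemma measurable_cell k : measurable (cell k : set pt).
Proof.
rewrite [X in measurable X](_ : _ = [set x : pt | forall j, tnth x j \in
    `[2 * pi * (k j)%:R / N%:R, 2 * pi * (k j).+1%:R / N%:R]]).
  exact: measurable_box.
by apply/seteqP; split => x /= H j; have := H j; rewrite in_itv.
Qed.

Context (N0 : (0 < N)%N).

Let pi2_gt0 : 0 < 2 * pi :> R. Proof. by rewrite mulr_gt0// pi_gt0. Qed.
Let NR_gt0 : 0 < N%:R :> R. Proof. by rewrite ltr0n. Qed.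

Lemma cell_scaled k x : cell k x <->
  forall j, (k j)%:R <= tnth x j * N%:R / (2 * pi) <= (k j).+1%:R.
Proof.
split=> H j; have := H j.
- by rewrite ler_pdivlMr// ler_pdivrMr// ler_pdivrMr// ler_pdivlMr// ![2 * pi * _]mulrC.
- by rewrite ler_pdivlMr// ler_pdivrMr// ler_pdivrMr// ler_pdivlMr// ![2 * pi * _]mulrC.
Qed.

(** The integer parts of the scaled coordinates give the cell; the strict bound x_j < 2 pi keeps
    them below N. *)
Lemma cell_cover x : torus R d x -> exists k, cell k x.
Proof.
move=> tx; pose t j := tnth x j * N%:R / (2 * pi).
have t0 j : 0 <= t j.
  by rewrite divr_ge0 ?mulr_ge0 ?pi_ge0//; case/andP: (tx j).
have tN j : (Num.truncn (t j) < N)%N.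
  have /andP[tj _] := truncn_itv (t0 j); rewrite -(ltr_nat R) (le_lt_trans tj)//.
  rewrite ltr_pdivrMr// mulrC ltr_pM2l//; by case/andP: (tx j).
exists [ffun j => Ordinal (tN j)]; apply/cell_scaled => j; rewrite ffunE/=.
by have := truncn_itv (t0 j); rewrite -/(t j) => /andP[-> /ltW].
Qed.

(* A point lying in a cell k is on the upper face of k in the j-th direction
   for certain j, and this set of directions determines k. *)
Lemma cell_multiplicity x : \sum_(k : idx) \1_(cell k : set pt) x <= 2 ^+ d :> R.
Proof.
pose t j := tnth x j * N%:R / (2 * pi).
pose face k : {ffun 'I_d -> bool} := [ffun j => (k j).+1%:R == t j].
pose K : {pred idx} := [pred k | `[< cell k x >]].
have face_inj : {in K &, injective face}.
  move=> k l /asboolP/cell_scaled kx /asboolP/cell_scaled lx /ffunP kl.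
  apply/ffunP => j; apply: val_inj => /=; have := kl j; rewrite !ffunE.
  have /andP[k1 k2] := kx j; have /andP[l1 l2] := lx j.
  (* On the upper face, k_j + 1 = t_j = l_j + 1. Off it, t_j lies in both half-open intervals [k_j,
     k_j + 1) and [l_j, l_j + 1), whence k_j = l_j. *)
  have [kt /esym/eqP lt|kt /esym/negbT lt] := eqVneq (k j).+1%:R (t j).
    by move: kt; rewrite -lt => /eqP; rewrite eqr_nat => /eqP[].
  have k3 : t j < (k j).+1%:R by rewrite lt_neqAle eq_sym kt.
  have l3 : t j < (l j).+1%:R by rewrite lt_neqAle eq_sym lt.
  have := le_lt_trans k1 l3; have := le_lt_trans l1 k3; rewrite !ltr_nat !ltnS.
  by move=> lk kl'; apply/eqP; rewrite eqn_leq lk kl'.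
have := leq_card_in _ _ face_inj; rewrite card_ffun card_bool card_ord.
rewrite -(ler_nat R) natrX; apply: le_trans.
rewrite -sum1_card natr_sum [leRHS]big_mkcond/= ler_sum// => k _.
rewrite indicE inE; case: asboolP => kx; last by rewrite memNset.
by rewrite mem_set.
Qed.

Lemma cell_dist k x y : cell k x -> cell k y -> forall j,
  `|tnth y j - tnth x j| <= 2 * pi / N%:R.
Proof.
move=> kx ky j; have /andP[x1 x2] := kx j; have /andP[y1 y2] := ky j.
have E : 2 * pi * (k j).+1%:R / N%:R = 2 * pi * (k j)%:R / N%:R + 2 * pi / N%:R :> R.
  by rewrite -natr1 -mulrDl; congr (_ / _); ring.
by rewrite ler_norml; move: x1 x2 y1 y2; rewrite E => *; apply/andP; split; lra.
Qed.

Definition discretization_re (xi : idx -> pt) (T : pt -> R[i]) (x : pt) : R :=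
  \sum_(k : idx) cabs (T (xi k)) * \1_(cell k : set pt) x.

Lemma discretizationE xi (T : pt -> R[i]) :
  discretization xi T = rc (discretization_re xi T).
Proof.
apply/funext => x; rewrite /discretization /rc /discretization_re rmorph_sum.
by apply: eq_bigr => k _; rewrite rmorphM.
Qed.

Lemma discretization_re_ge0 xi (T : pt -> R[i]) x : 0 <= discretization_re xi T x.
Proof. by apply: sumr_ge0 => k _; rewrite mulr_ge0 ?cabs_ge0. Qed.

Lemma cmeasurable_discretization xi (T : pt -> R[i]) :
  cmeasurable (discretization xi T).
Proof.
rewrite discretizationE; split; last exact: measurable_cst.
apply: measurable_sum => k; apply: measurable_funM; first exact: measurable_cst.
exact: measurable_indic (measurable_cell k).
Qed.

Lemma discretization_re_le xi (T : pt -> R[i]) x (g : R) :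
  0 <= g -> (forall k, cell k x -> cabs (T (xi k)) <= g) ->
  discretization_re xi T x <= 2 ^+ d * g.
Proof.
move=> g0 Tg; rewrite (@le_trans _ _ (\sum_(k : idx) \1_(cell k : set pt) x * g))//.
  apply: ler_sum => k _; rewrite mulrC indicE.
  have [/set_mem kx|_] := boolP (x \in _); last by rewrite !mul0r.
  by rewrite !mul1r Tg.
by rewrite -mulr_suml ler_wpM2r// cell_multiplicity.
Qed.

(** Overlaps of closed cells do no harm here, since they only add nonnegative terms. *)
Lemma le_discretization_re xi (T : pt -> R[i]) x k :
  cell k x -> cabs (T (xi k)) <= discretization_re xi T x.
Proof.
move=> kx; rewrite /discretization_re (bigD1 k)//= indicE mem_set// mulr1 lerDl.
by apply: sumr_ge0 => l _; rewrite mulr_ge0 ?cabs_ge0.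
Qed.

End Cells.

(** * The Taylor majorant and the two-sided estimate of the discretization *)

Section Discretization.
Context {R : realType} {d : nat}.
Local Notation pt := (d.-tuple R).
Context {mu : {measure set pt -> \bar R}} {q : R}.
Context {X : set (pt -> R[i])} {norm : (pt -> R[i]) -> R}.
Context (hX : quasi_banach_lattice mu q X norm) (q0 : 0 < q).

(** Turns the summability condition into a bound on finite sums; the bound by 1 makes the extended
    sum finite, so [fine] keeps its value. *)
Lemma esum_bound (I : choiceType) (A : set I) (f : I -> R) (s : seq I) :
  (forall a, 0 <= f a) -> (\esum_(a in A) (f a)%:E < 1%:E)%E ->
  uniq s -> [set` s] `<=` A ->
  \sum_(a <- s) f a <= fine (\esum_(a in A) (f a)%:E).
Proof.
move=> f0 f1 us sA.
have e0 : (0 <= \esum_(a in A) (f a)%:E)%E by apply: esum_ge0 => a _; rewrite lee_fin.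
rewrite -lee_fin fineK; last by rewrite ge0_fin_numE// (lt_trans f1)// ltry.
apply: esum_ge; exists [set` s]; first by split.
by rewrite -fsbig_seq// sumEFin.
Qed.

(** On a torus of finite measure, membership follows from the indicators of the cells, without the
    ideal property. *)
Lemma discretization_in_finite (N : nat) xi (T : pt -> R[i]) :
  (mu (torus R d) < +oo)%E -> X (@discretization R d N xi T).
Proof.
move=> mufin; rewrite discretizationE.
(* Closed cells at the boundary stick out of the half-open torus, so they are cut down to it;
   [qbl_ae] ignores the difference. *)
pose h (k : {ffun 'I_d -> 'I_N}) x :=
  cabs (T (xi k)) * \1_(cell k `&` torus R d : set pt) x.
have Xh k : X (rc (h k)).
  apply: (rcZ hX); apply: (qbl_indic hX).
  - by apply: measurableI; [exact: measurable_cell|exact: measurable_torus].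
  - by move=> x [].
  - apply: le_lt_trans mufin; apply: le_measure; rewrite ?inE.
    + by apply: measurableI; [exact: measurable_cell|exact: measurable_torus].
    + exact: measurable_torus.
    + by move=> x [].
apply: (qbl_ae hX (rc_sum hX q0 _ (index_enum _) _ Xh).1).
  by rewrite -discretizationE; exact: cmeasurable_discretization.
apply: aeW => x tx; congr (_%:C%C); apply: eq_bigr => k _.
by rewrite /h indicI/= [\1_(torus R d) x]indicE mem_set// mulr1.
Qed.

(** The expansion at x involves derivatives at x only, so the exceptional null set concerns x alone
    and y stays arbitrary. This is what allows arbitrary sample points later. *)
Lemma taylor_majorant (n : nat) (T : pt -> R[i]) (e A : R) (B : multiindex d -> R) (b : R) :
  0 <= e -> e * n%:R <= A -> (forall a, 0 < B a) -> trigpoly n T -> X T ->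
  (forall a, X (Dmi a T) /\ norm (Dmi a T) <= B a * n%:R ^+ mi_deg a * norm T) ->
  (forall s, uniq s -> [set` s] `<=` [set a | a <> [ffun=> 0%N]] ->
    \sum_(a <- s) (A ^+ mi_deg a * B a / (mi_fact a)%:R) `^ q <= b) ->
  exists g : pt -> R, [/\ X (rc g), (forall x, 0 <= g x),
    norm (rc g) `^ q <= b * norm T `^ q &
    {ae mu, forall x, torus R d x -> forall y,
      (forall j, `|tnth y j - tnth x j| <= e) -> cabs (T y - T x) <= g x}].
Proof.
move=> e0 enA B0 Tn XT DT sb.
have A0 : 0 <= A by rewrite (le_trans _ enA)// mulr_ge0.
pose h a x := taylor_weight e a * cabs (Dmi a T x).
have XD a : X (rc (fun x => cabs (Dmi a T x))) by apply: (qbl_mod hX); have [] := DT a.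
have w0 (a : multiindex d) := taylor_weight_ge0 e a e0.
have Xh a : X (rc (h a)) by exact: (rcZ hX).
have T0 : 0 <= norm T by exact: (qbl_norm_ge0 hX).
pose u a := A ^+ mi_deg a * B a / (mi_fact a)%:R.
have u0 a : 0 <= u a by rewrite divr_ge0// mulr_ge0 ?exprn_ge0// ltW.
have hE a : norm (rc (h a)) = taylor_weight e a * norm (Dmi a T).
  by rewrite (norm_rcZ hX (taylor_weight e a))// (norm_mod hX)//; have [] := DT a.
have Nh a : a != [ffun=> 0%N] -> norm (rc (h a)) `^ q <= u a `^ q * norm T `^ q.
  move=> a0; rewrite -powRM//.
  apply: ge0_ler_powR; first exact: ltW.
  - by rewrite nnegrE (qbl_norm_ge0 hX).
  - by rewrite nnegrE; apply: mulr_ge0.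
  rewrite hE (le_trans (ler_wpM2l (w0 a) (DT a).2))// mulrA ler_wpM2r//.
  rewrite /taylor_weight (negbTE a0) /u.
  (* The Bernstein factor n^|a| is absorbed into e^|a|, and e n <= A. *)
  have -> : e ^+ mi_deg a / (mi_fact a)%:R * (B a * n%:R ^+ mi_deg a) =
      (e * n%:R) ^+ mi_deg a * B a / (mi_fact a)%:R by rewrite exprMn; ring.
  rewrite ler_wpM2r ?invr_ge0// ler_wpM2r ?(ltW (B0 a))//.
  by rewrite lerXn2r ?nnegrE// mulr_ge0.
have Nh0 a : a = [ffun=> 0%N] -> norm (rc (h a)) `^ q = 0.
  move=> ->; rewrite hE /taylor_weight eqxx mul0r powR0//.
  by rewrite gt_eqF.
have [] := dominated_sum hX q0 _ h (b * norm T `^ q) _ Xh _.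
- by move=> a x; rewrite mulr_ge0// cabs_ge0.
(* The zero multi-index contributes 0, so the bound [sb] on the nonzero ones applies. *)
- move=> s us; rewrite (bigID (pred1 [ffun=> 0%N]))/= big1 ?add0r; last first.
    by move=> a /eqP; exact: Nh0.
  rewrite (le_trans (ler_sum _ Nh))// -mulr_suml ler_wpM2r ?powR_ge0//.
  rewrite -big_filter sb ?filter_uniq// => a /=.
  by rewrite mem_filter => /andP[/eqP].
- move=> g [Xg g0 Ng gP]; exists g; split=> //.
  by apply: filterS gP => x H tx y xy; apply: (trigpoly_dist_le n _ _ _ _ _ Tn xy) => s /H; apply.
Qed.

(** The estimates are kept in q-th powers, where the quasi-triangle inequality is additive and the
    term b ||T||^q can be moved across. *)
Lemma discretization_bounds (n N : nat) (T : pt -> R[i]) xi (b : R) (g : pt -> R) :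
  (0 < N)%N -> X T -> 0 <= b -> X (rc g) -> (forall x, 0 <= g x) ->
  norm (rc g) `^ q <= b * norm T `^ q ->
  {ae mu, forall x, torus R d x -> forall y,
      (forall j, `|tnth y j - tnth x j| <= 2 * pi / N%:R) -> cabs (T y - T x) <= g x} ->
  (forall k, cell k (xi k)) ->
  (solid mu X -> X (@discretization R d N xi T)) /\
  (X (@discretization R d N xi T) ->
    (1 - b) * norm T `^ q <= norm (discretization xi T) `^ q /\
    norm (discretization xi T) `^ q <= (2 ^+ d) `^ q * ((1 + b) * norm T `^ q)).
Proof.
move=> N0 XT b0 Xg g0 Ng gP xiP.
have XaT : X (rc (fun x => cabs (T x))) by exact: (qbl_mod hX).
(* Majorant of the discretization: at most 2^d cells contain x, and in each of them the sampled
   value is at most |T(x)| + g(x). *)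
pose U x := 2 ^+ d * (cabs (T x) + g x).
have XTg : X (rc (fun x => cabs (T x) + g x)) by exact: (rcD hX).
have XU : X (rc U) by exact: (rcZ hX).
have U0 x : 0 <= U x by rewrite mulr_ge0 ?exprn_ge0// addr_ge0 ?cabs_ge0.
have DU : {ae mu, forall x, torus R d x ->
    cabs (discretization xi T x) <= cabs (rc U x)}.
  apply: filterS gP => x H tx; rewrite discretizationE !cabs_real.
  rewrite !ger0_norm ?discretization_re_ge0//.
  apply: (discretization_re_le N0); first by rewrite addr_ge0 ?cabs_ge0.
  move=> k kx; rewrite -[T (xi k)](subrK (T x)) (le_trans (cabsD _ _))// addrC lerD2l.
  exact/(H tx)/(cell_dist k).
split=> [sX|XD].
  exact: (sX _ (rc U) (cmeasurable_discretization xi T)).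
have XDg : X (rc (fun x => discretization_re xi T x + g x)).
  by apply: (rcD hX) => //; rewrite -discretizationE.
split.
(* Some cell contains x; its sampled value is at most the discretization at x, and differs from T(x)
   by at most g(x). *)
- have TD : {ae mu, forall x, torus R d x ->
      cabs (T x) <= cabs (rc (fun x => discretization_re xi T x + g x) x)}.
    apply: filterS gP => x H tx; have [k kx] := cell_cover N0 x tx.
    rewrite cabs_real ger0_norm ?addr_ge0 ?discretization_re_ge0//.
    rewrite -[T x](subrK (T (xi k))) (le_trans (cabsD _ _))// addrC lerD//.
      exact: le_discretization_re.
    by rewrite cabsC; apply: (H tx); exact: (cell_dist k).
  have := qbl_norm_le hX XT XDg TD => /(ge0_ler_powR (ltW q0)).
  rewrite !nnegrE !(qbl_norm_ge0 hX)// => /(_ isT isT) NT.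
  have := norm_rcD hX (discretization_re xi T) g.
  rewrite -!discretizationE => /(_ XD Xg).
  by move: NT Ng; lra.
- have := qbl_norm_le hX XD XU DU => /(ge0_ler_powR (ltW q0)).
  rewrite !nnegrE !(qbl_norm_ge0 hX)// => /(_ isT isT) /le_trans; apply.
  rewrite (norm_rcZ hX) ?exprn_ge0// powRM ?exprn_ge0 ?(qbl_norm_ge0 hX)//.
  rewrite ler_wpM2l ?powR_ge0// (le_trans (norm_rcD hX _ _ XaT Xg))//.
  by rewrite (norm_mod hX)// mulrDl mul1r lerD2l.
Qed.

End Discretization.

(** * The norm equivalence with explicit constants *)

Theorem theorem4p9 (R : realType) (d : nat) (hd : (0 < d)%N)
    (mu : {measure set (d.-tuple R) -> \bar R})
    (hmu : sigma_finite (torus R d) mu)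
    (q : R) (hq0 : 0 < q) (hq1 : q <= 1)
    (X : set (d.-tuple R -> R[i])) (normX : (d.-tuple R -> R[i]) -> R)
    (hX : quasi_banach_lattice mu q X normX)
    (B : multiindex d -> R) (hB : forall a, 0 < B a)
    (A : R) (hA : 0 < A)
    (hBernstein : forall (a : multiindex d) (n : nat) (T : d.-tuple R -> R[i]),
       trigpoly n T -> X T ->
       X (Dmi a T) /\ normX (Dmi a T) <= B a * n%:R ^+ mi_deg a * normX T)
    (hsum : (\esum_(a in [set a : multiindex d | a <> [ffun=> 0%N]])
       ((A ^+ mi_deg a * B a / (mi_fact a)%:R) `^ q)%:E < 1%:E)%E) :
  exists c C : R, [/\ 0 < c, 0 < C &
    forall (n N : nat) (T : d.-tuple R -> R[i])
      (xi : {ffun 'I_d -> 'I_N} -> d.-tuple R),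
      trigpoly n T -> X T ->
      (0 < N)%N -> 2 * pi / A * n%:R <= N%:R ->
      (forall k, cell k (xi k)) ->
      (solid mu X \/ (mu (torus R d) < +oo)%E -> X (discretization xi T)) /\
      (X (discretization xi T) ->
         c * normX T <= normX (discretization xi T) <= C * normX T)].
Proof.
pose u (a : multiindex d) := (A ^+ mi_deg a * B a / (mi_fact a)%:R) `^ q.
pose b := fine (\esum_(a in [set a : multiindex d | a <> [ffun=> 0%N]]) (u a)%:E).
have u0 a : 0 <= u a by exact: powR_ge0.
have b0 : 0 <= b by apply/fine_ge0/esum_ge0 => a _; rewrite lee_fin.
have b1 : b < 1.
  rewrite -lte_fin fineK// ge0_fin_numE; first by rewrite (lt_trans hsum)// ltry.
  by apply: esum_ge0 => a _; rewrite lee_fin.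
have root_gt0 (r : R) : 0 < r -> 0 < r `^ q^-1 by exact: powR_gt0.
have rootK (r : R) : 0 < r -> (r `^ q^-1) `^ q = r.
  by move=> r0; rewrite -powRrM mulVf ?gt_eqF// powRr1// ltW.
have c0 : 0 < 1 - b by rewrite subr_gt0.
have C0 : 0 < 1 + b by rewrite ltr_wpDr.
(* The q-th roots of the factors 1 - b and 2^(dq) (1 + b); they depend only on b, d and q, hence not
   on n, N, T or the sample points. *)
exists ((1 - b) `^ q^-1), (2 ^+ d * (1 + b) `^ q^-1).
split; [exact: root_gt0|by rewrite mulr_gt0 ?exprn_gt0 ?root_gt0|].
move=> n N T xi Tn XT N0 NA xiP.
have e0 : 0 <= 2 * pi / N%:R :> R by rewrite divr_ge0// mulr_ge0 ?pi_ge0.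
(* The condition on N says exactly that the mesh size times n is at most A. *)
have enA : 2 * pi / N%:R * n%:R <= A.
  rewrite mulrAC ler_pdivrMr ?ltr0n//; move: NA.
  by rewrite mulrAC ler_pdivrMr// [N%:R * A]mulrC.
have sb s : uniq s -> [set` s] `<=` [set a | a <> [ffun=> 0%N]] ->
    \sum_(a <- s) (A ^+ mi_deg a * B a / (mi_fact a)%:R) `^ q <= b.
  by move=> us sA; exact: (esum_bound _ _ u).
have [g [Xg g0 Ng gP]] := taylor_majorant hX hq0 n T _ A B b e0 enA hB Tn XT
  (fun a => hBernstein a n T Tn XT) sb.
have [solidX DX] := discretization_bounds hX hq0 n N T xi b g N0 XT b0 Xg g0 Ng gP xiP.
split=> [[sX|mufin]|XD]; [exact: solidX|exact: (discretization_in_finite hX hq0)|].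
have [lo hi] := DX XD.
have T0 : 0 <= normX T by exact: (qbl_norm_ge0 hX).
have D0 : 0 <= normX (discretization xi T) by exact: (qbl_norm_ge0 hX).
apply/andP; split; apply: (powR_le_inj hq0) => //.
- by rewrite mulr_ge0// ltW// root_gt0.
- by rewrite powRM ?(ltW (root_gt0 _ _))// rootK.
- by rewrite !mulr_ge0 ?exprn_ge0// ltW// root_gt0.
- rewrite powRM ?mulr_ge0 ?exprn_ge0 ?(ltW (root_gt0 _ _))//.
  by rewrite powRM ?exprn_ge0 ?(ltW (root_gt0 _ _))// rootK// -mulrA.
Qed.
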